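(* Let $n\ge 5$ be an integer. (1) For $2\leq \ell \leq n-1$, $e_{n-2}(n,\ell,n-1)=n-1$. (2) For $2\leq \ell \leq n-1$, $$e_{n-2}(n,\ell,n-2)=\begin{cases} n, & \text{if } 2\leq \ell \leq n-2,\\ n-1, & \text{if } \ell=n-1.\end{cases}$$ (3) The following hold for $i\in\{0,1\}$: - $e_{n-2}(n,n-1-i,n-3)=2n-2$ whenever $n\geq 5+i$; - $e_{n-2}(n,n-3-i,n-3)=2n-3$ whenever $n\geq 7+2i$; - $e_{n-2}(n,n-5-i,n-3)=2n-4$ whenever $n\geq 11+2i$; - $e_{n-2}(n,n-7-i,n-3)=2n-5$ whenever $n\geq 15+2i$. Moreover, for $6\leq \ell \leq n-9$, let $s$ be the unique integer with $2\le s\le 5$ such that $n=4r+\ell+s+3$ for some integer $r\ge 1$. Then $$\tfrac{1}{2}(3n+\ell-3)\leq e_{n-2}(n,\ell,n-3)\leq \tfrac{1}{2}(3n+\ell+s-5),$$ and if $s=2$, then $e_{n-2}(n,\ell,n-3)=\frac{1}{2}(3n+\ell-3)$.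
   Context: All graphs are finite, simple and undirected; $e(G)$ is the number of edges of $G$ and $\Delta(G)$ its maximum degree. For a graph $G$ and a nonempty set $S\subseteq V(G)$, the Steiner distance $d_G(S)$ is the minimum number of edges of a connected subgraph of $G$ whose vertex set contains $S$, with $d_G(S)=\infty$ if there is no such subgraph. For $2\le k\le n=|V(G)|$, the Steiner $k$-diameter is $sdiam_k(G)=\max\{d_G(S) : S\subseteq V(G),\ |S|=k\}$ (so it is $\infty$ if some $k$-set lies in no connected subgraph). For natural numbers $n,\ell,d$ with $\ell<n$ and $d<n$, $\mathscr{H}_k(n,\ell,d)$ is the set of all graphs $G$ of order $n$ with maximum degree exactly $\ell$ and $sdiam_k(G)\le d$, and $e_k(n,\ell,d)=\min\{e(G): G\in\mathscr{H}_k(n,\ell,d)\}$, with $e_k(n,\ell,d)=\infty$ if $\mathscr{H}_k(n,\ell,d)$ is empty. The parameter $k$ is assumed to satisfy $3\le k\le n$. *)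

(* Defs.v *)
From HB Require Import structures.
From mathcomp Require Import all_boot all_order all_algebra.
From mathcomp Require Import constructive_ereal.

Set Implicit Arguments.
Unset Strict Implicit.
Unset Printing Implicit Defensive.

Import Order.TTheory GRing.Theory Num.Theory.

Section Graphs.
Variable T : finType.

(* A finite simple graph on T is a set of two-element subsets of T. *)
Record sgraph := SGraph {
  edges :> {set {set T}};
  edges_card2 : [forall e in edges, #|e| == 2]
}.

HB.instance Definition _ := [isSub for edges].
HB.instance Definition _ := [Finite of sgraph by <:].

Implicit Types (G : sgraph) (H : {set T} * {set {set T}}) (S : {set T}).

(* {x, x} is a singleton, hence never an edge: x is not its own neighbour. *)
Definition degree G (x : T) : nat := #|[set y | [set x; y] \in edges G]|.

Definition max_degree G : nat := \max_(x : T) degree G x.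

(* H = (H.1, H.2) stands for the graph with vertex set H.1 and edge set H.2;
   here the edges of H must be edges of G with both ends in H.1. *)
Definition subgraph H G : bool :=
  (H.2 \subset edges G) && [forall e in H.2, e \subset H.1].

(* Meant for pairs H satisfying subgraph H G, whose paths stay in H.1. *)
Definition connected_graph H : bool :=
  (H.1 != set0) &&
  [forall x in H.1, forall y in H.1,
     connect (fun u v : T => [set u; v] \in H.2) x y].

(* Values lie in rat extended by infinities; the minimum of an empty family
   is +oo. *)
Definition steiner_dist G S : \bar rat :=
  \big[mine/+oo%E]_(H : {set T} * {set {set T}} |
         [&& subgraph H G, connected_graph H & S \subset H.1])
     (#|H.2|%:R)%:E%E.

(* For 2 <= k <= #|T| the family is nonempty, so the default -oo plays no
   role. *)
Definition sdiam (k : nat) G : \bar rat :=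
  \big[maxe/-oo%E]_(S : {set T} | #|S| == k) steiner_dist G S.

End Graphs.

(* Graphs of order n are taken with vertex set {0, ..., n-1}. *)
Definition HH (k n l d : nat) : {set sgraph 'I_n} :=
  [set G : sgraph 'I_n | (max_degree G == l) && (sdiam k G <= d%:R%:E)%E].

Definition emin (k n l d : nat) : \bar rat :=
  \big[mine/+oo%E]_(G in HH k n l d) (#|edges G|%:R)%:E%E.

(* Main.v *)
Require Import Defs.
From mathcomp Require Import all_boot all_order all_algebra.
From mathcomp Require Import constructive_ereal.
From mathcomp Require Import zify lra.

Import Order.TTheory GRing.Theory Num.Theory.

(* For k = n - 2 the Steiner diameter condition only speaks about deleting two
   vertices: a bound n - 1 means connected, a bound n - 2 means that of any two
   vertices one can be deleted (possibly with the other) without disconnecting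
   the rest, and a bound n - 3 means 3-connected.
   - Bound n - 1: trees are optimal, and a broom has the required degree.
   - Bound n - 2: with at most n - 1 edges no two vertices have degree at least
     2, so the degree sum is at most l + (n - 1), which forces l = n - 1. A cycle
     with pendant vertices attached at one point has n edges.
   - Bound n - 3: all degrees are at least 3, so 2e >= 3(n - 1) + l. For every
     4 <= l <= n - 1 this is sharp up to parity: on a rim cycle take two
     classes of consecutive vertices separated by other rim vertices, match
     them by chords, and join all remaining rim vertices to a hub. If
     n - 1 - l is odd, one chord end is also joined to the hub. *)

(** * Connected subgraphs, spanning trees and Steiner distance *)

Section SteinerDistance.
Context {T : finType}.
Implicit Types (E F : {set {set T}}) (S W : {set T}) (G : sgraph T).

Lemma connect_sym_edges E : connect_sym (fun u v : T => [set u; v] \in E).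
Proof. by apply: sym_connect_sym => u v; rewrite setUC. Qed.

Lemma connected_graph_root W E r :
    r \in W -> {in W, forall x, connect (fun u v : T => [set u; v] \in E) x r} ->
  connected_graph (W, E).
Proof.
move=> rW toR; apply/andP; split; first by apply/set0Pn; exists r.
apply/forall_inP => x xW; apply/forall_inP => y yW.
by apply: connect_trans (toR x xW) _; rewrite connect_sym_edges toR.
Qed.

Lemma connected_graphP W E :
  connected_graph (W, E) ->
  W != set0 /\ {in W &, forall x y, connect (fun u v : T => [set u; v] \in E) x y}.
Proof.
case/andP=> W0 /forall_inP cW; split=> // x y xW yW.
by move/forall_inP: (cW x xW); apply.
Qed.

(** Without such an edge, [W] would be closed under adjacency and would contain everything reachable
    from [x], hence [y]. *)
Lemma connected_graph_leaving_edge W E x y :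
    connect (fun u v : T => [set u; v] \in E) x y -> x \in W -> y \notin W ->
  exists u v, [/\ u \in W, v \notin W & [set u; v] \in E].
Proof.
move=> cxy xW yW; case: (boolP [exists u in W, exists v,
    (v \notin W) && ([set u; v] \in E)]) => [|none].
  by case/exists_inP=> u uW /existsP[v /andP[vW uvE]]; exists u, v.
have /closed_connect/(_ x y cxy) : closed (fun u v : T => [set u; v] \in E) (mem W).
  apply: intro_closed; first exact: connect_sym_edges.
  move=> u v uvE uW; apply: contraNT none => vW.
  by apply/exists_inP; exists u => //; apply/existsP; exists v; rewrite vW.
by rewrite xW (negPf yW).
Qed.

(** Start from one vertex and repeatedly add an edge leaving the current vertex set: each step adds
    exactly one vertex and one edge. With [k = #|W|] this gives a spanning tree. *)
Lemma connected_subtree W E k :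
    connected_graph (W, E) -> {in E, forall e : {set T}, e \subset W} -> 0 < k <= #|W| ->
  exists W' F, [/\ W' \subset W, #|W'| = k & F \subset E] /\
    [/\ connected_graph (W', F), {in F, forall e : {set T}, e \subset W'} & #|F| = k.-1].
Proof.
move=> /connected_graphP[/set0Pn[x0 x0W] cW] EW.
elim: k => // -[_ _|k IHk /andP[_ ltkW]].
  exists [set x0], set0; do 2!split; rewrite ?cards1 ?cards0 ?sub0set ?sub1set //.
    apply: (@connected_graph_root _ _ x0) => [|x]; first exact: set11.
    by move/set1P->.
  by move=> e; rewrite inE.
have /IHk[W' [F [[sW'W cardW' sFE] [cF FW' cardF]]]] : 0 < k.+1 <= #|W| by lia.
have /subsetPn[y yW yW'] : ~~ (W \subset W').
  by apply/negP => /subset_leq_card; rewrite cardW'; lia.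
have [/set0Pn[x xW'] cW'] := connected_graphP _ _ cF.
have [u [v [uW' vW' uvE]]] :=
  connected_graph_leaving_edge _ _ _ _ (cW _ _ (subsetP sW'W x xW') yW) xW' yW'.
have vW : v \in W by apply: (subsetP (EW _ uvE)); rewrite !inE eqxx orbT.
exists (v |: W'), ([set u; v] |: F); do 2!split.
- by rewrite subUset sub1set vW.
- by rewrite cardsU1 vW' cardW'.
- by rewrite subUset sub1set uvE.
- apply: (@connected_graph_root _ _ u) => [|z]; first by rewrite !inE uW' orbT.
  case/setU1P=> [->|zW'].
    by apply: connect1; rewrite !inE setUC eqxx.
  apply: connect_sub (cW' z u zW' uW') => a b abF.
  by apply: connect1; rewrite inE abF orbT.
- move=> e /setU1P[->|eF]; last exact: subset_trans (FW' e eF) (subsetUr _ _).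
  by rewrite subUset !sub1set !inE eqxx uW' orbT.
- rewrite cardsU1 cardF (_ : _ \notin F) //.
  apply: contra vW' => /FW'/subsetP; apply.
  by rewrite !inE eqxx orbT.
Qed.

Lemma leq_card_connected W E :
  connected_graph (W, E) -> {in E, forall e : {set T}, e \subset W} -> #|W| <= #|E|.+1.
Proof.
move=> cWE EW; have [] := connected_subtree W E #|W| cWE EW.
  by rewrite leqnn andbT card_gt0; case/andP: cWE.
move=> W' [F [[_ _ /subset_leq_card leFE] [_ _ cardF]]].
by rewrite -(leq_sub2rE (p := 1)) // subn1 -cardF subSS subn0.
Qed.

Definition induced_edges G W : {set {set T}} := [set e in edges G | e \subset W].

Lemma steiner_dist_leP G S (d : nat) :
  reflect (exists W F, [/\ F \subset edges G, {in F, forall e : {set T}, e \subset W},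
             connected_graph (W, F), S \subset W & #|F| <= d])
    (steiner_dist G S <= (d%:R)%:E)%E.
Proof.
apply: (iffP idP) => [|[W [F [sFG FW cF sSW leFd]]]]; last first.
  rewrite /steiner_dist; apply: (bigmin_inf (W, F)).
    by rewrite /subgraph /= sFG cF sSW !andbT; apply/forall_inP.
  by rewrite lee_fin ler_nat.
rewrite leNgt => /negP far.
case: (pickP (fun H => [&& subgraph H G, connected_graph H, S \subset H.1
                          & #|H.2| <= d])).
  move=> [W F] /and4P[/andP[/= sFG /forall_inP FW] cF sSW leFd].
  by exists W, F.
move=> none; case: far; apply/bigmin_gtP; split.
  (* The default [+oo] of the minimum lies above every natural bound, so a finite bound always has a
     witness. *)
  exact: ltry.
move=> H /and3P[sH cH sSH]; rewrite lte_fin ltr_nat ltnNge.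
by have := none H; rewrite sH cH sSH /= => ->.
Qed.

Lemma steiner_dist_connected G S W :
    S \subset W -> connected_graph (W, induced_edges G W) ->
  (steiner_dist G S <= (#|W|.-1%:R)%:E)%E.
Proof.
move=> sSW cW; have W_gt0 : 0 < #|W| by rewrite card_gt0; case/andP: cW.
have EW : {in induced_edges G W, forall e : {set T}, e \subset W}.
  by move=> e; rewrite inE => /andP[].
have /(connected_subtree _ _ _ cW EW) : 0 < #|W| <= #|W| by rewrite W_gt0 leqnn.
case=> W' [F [[sW'W cardW' sF] [cF FW' cardF]]].
have eqW' : W' = W by apply/eqP; rewrite eqEcard sW'W cardW' leqnn.
apply/steiner_dist_leP; exists W, F; rewrite -eqW' cardW' cardF eqW'; split=> //.
- by apply: subset_trans sF _; apply/subsetP => e; rewrite inE => /andP[].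
- by rewrite -eqW'.
- by rewrite -eqW'.
Qed.

Lemma sdiam_leP (k d : nat) G :
  reflect (forall S, #|S| = k -> (steiner_dist G S <= (d%:R)%:E)%E)
    (sdiam k G <= (d%:R)%:E)%E.
Proof.
apply: (iffP (bigmax_leP _ _ _ _)) => [[_ le] S /eqP|le].
  exact: le.
by split=> [|S /eqP]; [exact: leNye | exact: le].
Qed.

(** A spanning tree of a connected induced subgraph on at most [d.+1] vertices has at most [d]
    edges. All upper bounds on the Steiner diameter go through this criterion. *)
Lemma sdiam_le_connected (k d : nat) G :
    (forall S, #|S| = k -> exists W,
       [/\ S \subset W, #|W| <= d.+1 & connected_graph (W, induced_edges G W)]) ->
  (sdiam k G <= (d%:R)%:E)%E.
Proof.
move=> conn; apply/sdiam_leP => S /conn[W [sSW leWd cW]].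
apply: le_trans (steiner_dist_connected _ _ _ sSW cW) _.
by rewrite lee_fin ler_nat; lia.
Qed.

(** * Degrees, stars and graphs given by a relation *)

Definition star G x : {set {set T}} := [set e in edges G | x \in e].

Lemma edgeP G e : e \in edges G -> exists x y, x != y /\ e = [set x; y].
Proof. by case: G => E /= /forall_inP cE /cE/cards2P. Qed.

Lemma edge_neq G x y : [set x; y] \in edges G -> x != y.
Proof.
case: G => E /= /forall_inP cE /cE.
by rewrite cards2; case: (x != y).
Qed.

Lemma card_star G x : #|star G x| = degree G x.
Proof.
rewrite /degree -(card_in_imset (f := fun y => [set x; y])); last first.
  move=> y z; rewrite !inE => /edge_neq xy /edge_neq xz /setP/(_ y).
  by rewrite !inE eqxx orbT eq_sym (negPf xy) /= => /esym/eqP.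
apply: eq_card => e; rewrite inE; apply/andP/imsetP => [[eG xe]|[y yG ->]].
  have [a [b [ab def_e]]] := edgeP _ _ eG.
  move: xe; rewrite def_e !inE => /orP[]/eqP def_x.
    by exists b; rewrite ?inE def_x // -def_e.
  by exists a; rewrite ?inE def_x setUC // -def_e.
by move: yG; rewrite !inE eqxx.
Qed.

(** Incident pairs of a vertex and an edge are counted in both orders. *)
Lemma sum_degree G : \sum_(x : T) degree G x = 2 * #|edges G|.
Proof.
under eq_bigr => x _ do rewrite -card_star -sum1_card.
under eq_bigr => x _ do under eq_bigl => e do rewrite inE.
rewrite (exchange_big_dep (fun e => e \in edges G)) /=; last by move=> x e _ /andP[].
rewrite mulnC -sum_nat_const; apply: eq_bigr => e eG.
rewrite (eq_bigl (fun x => x \in e)) => [|x]; last by rewrite eG.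
rewrite sum1_card; case: G eG => E /= /forall_inP cE /cE/eqP //.
Qed.

Lemma degree_le_max G x : degree G x <= max_degree G.
Proof. exact: leq_bigmax. Qed.

Definition rel_graph (r : rel T) : sgraph T.
Proof.
exists [set [set p.1; p.2] | p : T * T & (p.1 != p.2) && r p.1 p.2].
by apply/forall_inP => _ /imsetP[p + ->]; rewrite inE cards2 => /andP[-> _].
Defined.

Lemma rel_graphE (r : rel T) x y :
  symmetric r -> ([set x; y] \in edges (rel_graph r)) = (x != y) && r x y.
Proof.
move=> r_sym; apply/imsetP/idP => [[[a b]]|xy]; last by exists (x, y); rewrite ?inE.
rewrite inE /= => /andP[ab rab] E.
have : x \in [set a; b] by rewrite -E !inE eqxx.
have : y \in [set a; b] by rewrite -E !inE eqxx orbT.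
have : a \in [set x; y] by rewrite E !inE eqxx.
have : b \in [set x; y] by rewrite E !inE eqxx orbT.
rewrite !inE; do 4![case/orP=> /eqP ?]; subst => //;
  by [rewrite eqxx in ab | rewrite ab rab | rewrite eq_sym ab r_sym rab].
Qed.

End SteinerDistance.

(** * Lower bounds on the number of edges *)

Section LowerBounds.
Context {T : finType}.
Implicit Types (A B S : {set T}) (G : sgraph T).

Lemma exists_set_between A B k :
    A \subset B -> #|A| <= k <= #|B| ->
  exists S, [/\ A \subset S, S \subset B & #|S| = k].
Proof.
move=> sAB; elim: k => [|k IHk] /andP[leA leB].
  by exists A; split=> //; lia.
have [eqA|neqA] := eqVneq #|A| k.+1; first by exists A.
have /IHk[S [sAS sSB cardS]] : #|A| <= k <= #|B| by lia.
have /subsetPn[x xB xS] : ~~ (B \subset S).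
  by apply/negP => /subset_leq_card; lia.
exists (x |: S); split; last by rewrite cardsU1 xS cardS.
  exact: subset_trans sAS (subsetUr _ _).
by rewrite subUset sub1set xB.
Qed.

(** Since [k > 1], any vertex lies in a [k]-set together with a fixed root, and a finite Steiner
    distance of that set links the two. So [G] is connected. *)
Lemma sdiam_card_edges (k d : nat) G :
    1 < k <= #|T| -> (sdiam k G <= (d%:R)%:E)%E -> #|T|.-1 <= #|edges G|.
Proof.
move=> /andP[k_gt1 lek] /sdiam_leP diam.
have /card_gt0P[r _] : 0 < #|T| by lia.
suff /leq_card_connected : connected_graph ([set: T], edges G).
  by rewrite cardsT => leE; have := leE (fun e _ => subsetT e); lia.
apply: (@connected_graph_root _ _ _ r) => // x _.
have [||S [sxr _ cardS]] := exists_set_between [set x; r] [set: T] k.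
- exact: subsetT.
- by rewrite cardsT lek cards2 andbT; case: (x != r) => //; lia.
have /steiner_dist_leP[W [F [sFG _ cF sSW _]]] := diam S cardS.
have [_ cW] := connected_graphP _ _ cF.
apply: connect_sub (cW x r _ _) => [a b abF||].
- by apply: connect1; apply: (subsetP sFG).
- by apply: (subsetP sSW); apply: (subsetP sxr); rewrite !inE eqxx.
- by apply: (subsetP sSW); apply: (subsetP sxr); rewrite !inE eqxx orbT.
Qed.

(** If [x] had at most two neighbours, some set [S] of [#|T| - 2] vertices would contain [x] and
    none of them. A connected subgraph with [#|T| - 3] edges has at most [#|T| - 2] vertices, so its
    vertex set would be [S] itself, in which [x] is isolated. *)
Lemma sdiam_degree_ge3 G x :
    3 < #|T| -> (sdiam (#|T| - 2) G <= ((#|T| - 3)%N%:R)%:E)%E ->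
  2 < degree G x.
Proof.
move=> T_gt3 /sdiam_leP diam; rewrite ltnNge; apply/negP => deg_le2.
have nxx : x \notin [set y | [set x; y] \in edges G].
  by rewrite inE; apply/negP => /edge_neq; rewrite eqxx.
have [||S [xS sSN cardS]] := exists_set_between [set x]
    (~: [set y | [set x; y] \in edges G]) (#|T| - 2).
- by rewrite sub1set inE nxx.
- rewrite cards1; have := cardsC [set y | [set x; y] \in edges G].
  by rewrite /degree in deg_le2; lia.
have /steiner_dist_leP[W [F [sFG FW cF sSW leF]]] := diam S cardS.
have eqW : S = W.
  apply/eqP; rewrite eqEcard sSW cardS.
  by have := leq_card_connected _ _ cF FW; lia.
have xW : x \in W by rewrite -eqW -sub1set.
have /subsetPn[y yW yx] : ~~ (W \subset [set x]).
  by apply/negP => /subset_leq_card; rewrite cards1 -eqW cardS; lia.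
have [_ cW] := connected_graphP _ _ cF.
have [u [v [/set1P-> _ uvF]]] :=
  connected_graph_leaving_edge _ _ _ _ (cW x y xW yW) (set11 x) yx.
have vW : v \in W by apply: (subsetP (FW _ uvF)); rewrite !inE eqxx orbT.
move: vW; rewrite -eqW => /(subsetP sSN).
by rewrite !inE (subsetP sFG _ uvF).
Qed.

Lemma sdiam_double_edges G :
    3 < #|T| -> (sdiam (#|T| - 2) G <= ((#|T| - 3)%N%:R)%:E)%E ->
  3 * #|T|.-1 + max_degree G <= 2 * #|edges G|.
Proof.
move=> T_gt3 diam; rewrite -sum_degree /max_degree.
have [|x ->] := bigop.eq_bigmax (degree G); first by lia.
rewrite (bigD1 x) //= addnC leq_add2l mulnC -(cardC1 x) -sum_nat_const.
by apply: leq_sum => y _; exact: sdiam_degree_ge3.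
Qed.

Lemma card_induced_edges1 G (W : {set T}) (F : {set {set T}}) u :
    F \subset edges G -> {in F, forall e : {set T}, e \subset W} -> u \notin W ->
  #|F| + degree G u <= #|edges G|.
Proof.
move=> sFG FW uW; rewrite -card_star.
have -> : #|F| + #|star G u| = #|F :|: star G u|.
  rewrite cardsU (_ : F :&: _ = set0) ?cards0 ?subn0 //.
  apply/setP => e; rewrite !inE; apply/negP => /and3P[/FW/subsetP sW _ /sW].
  exact/negP.
by apply: subset_leq_card; rewrite subUset sFG; apply/subsetP => e; rewrite inE => /andP[].
Qed.

(** The stars of [u] and [v] avoid [F] and share at most the edge [[set u; v]], which accounts for
    the successor on the right. *)
Lemma card_induced_edges2 G (W : {set T}) (F : {set {set T}}) u v :
    F \subset edges G -> {in F, forall e : {set T}, e \subset W} ->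
    u \notin W -> v \notin W -> u != v ->
  #|F| + degree G u + degree G v <= #|edges G|.+1.
Proof.
move=> sFG FW uW vW uv; rewrite -!card_star.
have leI : #|(F :|: star G u) :&: star G v| <= 1.
  rewrite -(cards1 [set u; v]); apply: subset_leq_card.
  apply/subsetP => e; rewrite !inE => /andP[/orP[eF|/andP[_ ue]] /andP[eG ve]].
    by have /subsetP/(_ v ve) := FW e eF; rewrite (negPf vW).
  have [a [b [ab def_e]]] := edgeP _ _ eG.
  rewrite eq_sym eqEcard {2}def_e !cards2 uv ab leqnn andbT.
  by rewrite subUset !sub1set ue.
have -> : #|F| + #|star G u| = #|F :|: star G u|.
  rewrite cardsU (_ : F :&: _ = set0) ?cards0 ?subn0 //.
  apply/setP => e; rewrite !inE; apply/negP => /and3P[/FW/subsetP sW _ /sW].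
  exact/negP.
rewrite -cardsUI -addn1; apply: leq_add leI; apply: subset_leq_card.
by rewrite !subUset sFG; apply/andP; split; apply/subsetP => e; rewrite inE => /andP[].
Qed.

(** Take a connected subgraph containing all vertices but [u] and [v]. If it contained both, it
    would span [T] with at most [#|T| - 2] edges, which is too few. If it misses exactly one, the
    star of that vertex adds at least 2 to at least [#|T| - 2] edges; if it misses both, the two
    stars add at least 3 to at least [#|T| - 3]. *)
Lemma sdiam_two_degrees G u v :
    2 < #|T| -> (sdiam (#|T| - 2) G <= ((#|T| - 2)%N%:R)%:E)%E ->
    u != v -> 1 < degree G u -> 1 < degree G v ->
  #|T| <= #|edges G|.
Proof.
move=> T_gt2 /sdiam_leP diam uv du dv.
have cardS : #|~: [set u; v]| = #|T| - 2.
  by have := cardsC [set u; v]; rewrite cards2 uv; lia.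
have /steiner_dist_leP[W [F [sFG FW cF sSW leF]]] := diam _ cardS.
have leW := leq_card_connected _ _ cF FW.
have leSW := subset_leq_card sSW; rewrite cardS in leSW.
have [uW|uW] := boolP (u \in W); have [vW|vW] := boolP (v \in W).
- suff : #|W| = #|T| by lia.
  rewrite -cardsT; congr #|pred_of_set _|; apply/eqP; rewrite eqEsubset subsetT.
  rewrite -(setUCr [set u; v]) subUset sSW andbT.
  by apply/subsetP => x /set2P[]->.
- have := card_induced_edges1 _ _ _ _ sFG FW vW.
  suff : #|~: [set u; v]| < #|W| by lia.
  apply: proper_card; rewrite properE sSW; apply/subsetPn; exists u => //.
  by rewrite !inE eqxx.
- have := card_induced_edges1 _ _ _ _ sFG FW uW.
  suff : #|~: [set u; v]| < #|W| by lia.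
  apply: proper_card; rewrite properE sSW; apply/subsetPn; exists v => //.
  by rewrite !inE eqxx orbT.
- by have := card_induced_edges2 _ _ _ _ _ sFG FW uW vW uv; lia.
Qed.

Lemma sdiam_edges_ge_order G :
    3 < #|T| -> (sdiam (#|T| - 2) G <= ((#|T| - 2)%N%:R)%:E)%E ->
    max_degree G <= #|T| - 2 ->
  #|T| <= #|edges G|.
Proof.
move=> T_gt3 diam leD; rewrite leqNgt; apply/negP => ltE.
have geE : #|T|.-1 <= #|edges G| by apply: sdiam_card_edges diam; lia.
have [|x maxx] := bigop.eq_bigmax (degree G); first by lia.
(* A second vertex of degree at least 2 would, together with [x], force [#|T|] edges. *)
have deg1 y : y != x -> degree G y <= 1.
  move=> yx; rewrite leqNgt; apply/negP => dy.
  have dx : 1 < degree G x by rewrite -maxx (leq_trans dy) // degree_le_max.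
  have := sdiam_two_degrees _ _ _ _ diam yx dy dx; lia.
have := sum_degree G; rewrite (bigD1 x) //=; set s := (s in _ + s) => sumE.
have : s <= #|T|.-1 * 1.
  by rewrite -(cardC1 x) -sum_nat_const; apply: leq_sum.
have {}sumE : degree G x + s = 2 * #|edges G| := sumE.
have := degree_le_max G x; lia.
Qed.

End LowerBounds.

(** * Extremal graphs on the vertices [0, ..., n-1] *)

Section Constructions.
Context {n : nat}.
Implicit Types (G : sgraph 'I_n) (W S : {set 'I_n}).

(** Neighbours are compared through their values in [nat], so [s] may contain repetitions or numbers
    that are not vertices. *)
Lemma degree_le_size G x (s : seq nat) :
    (forall y : 'I_n, [set x; y] \in edges G -> (y : nat) \in s) ->
  degree G x <= size s.
Proof.
move=> Ns; rewrite /degree cardE -(size_map val); apply: uniq_leq_size.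
  by rewrite (map_inj_uniq val_inj) enum_uniq.
by move=> _ /mapP[y + ->]; rewrite mem_enum inE => /Ns.
Qed.

Lemma degree_ge_size G x (s : seq nat) :
    uniq s ->
    {in s, forall k, exists2 y : 'I_n, y = k :> nat & [set x; y] \in edges G} ->
  size s <= degree G x.
Proof.
move=> s_uniq sN; rewrite /degree cardE -(size_map val); apply: uniq_leq_size => //.
by move=> k /sN[y <- yN]; apply: map_f; rewrite mem_enum inE.
Qed.

Lemma max_degreeP G l x :
  (forall y, degree G y <= l) -> l <= degree G x -> max_degree G = l.
Proof.
move=> le ge; apply/eqP; rewrite eqn_leq; apply/andP; split.
  by apply/bigmax_leqP => y _; exact: le.
by apply: leq_trans ge (degree_le_max _ _).
Qed.

Lemma connected_induced_root G W r :
    r \in W ->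
    {in W, forall x,
      connect (fun u v => [&& u \in W, v \in W & [set u; v] \in edges G]) x r} ->
  connected_graph (W, induced_edges G W).
Proof.
move=> rW toR; apply: (@connected_graph_root _ _ _ r) => // x /toR.
apply: connect_sub => u v /and3P[uW vW uvG]; apply: connect1.
by rewrite inE uvG subUset !sub1set uW.
Qed.

Lemma connect_walk (e : rel 'I_n) (x y : 'I_n) :
    x <= y -> (forall u v : 'I_n, x <= u -> v <= y -> v = u.+1 :> nat -> e u v) ->
  connect e x y.
Proof.
move=> /subnKC; move: (y - x) => d; elim: d x => [|d IHd] x.
  by rewrite addn0 => /val_inj-> _.
move=> def_y step.
have ltx1 : x.+1 < n by apply: leq_ltn_trans (ltn_ord y); lia.
apply: connect_trans (connect1 (step x (Ordinal ltx1) _ _ _)) (IHd _ _ _) => //=.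
- by lia.
- by lia.
- by move=> u v lexu levy; apply: step => //; lia.
Qed.

Definition nat_graph (r : rel nat) : sgraph 'I_n :=
  rel_graph (fun x y : 'I_n => r x y || r y x).

Lemma nat_graphE (r : rel nat) (x y : 'I_n) :
  ([set x; y] \in edges (nat_graph r)) = (x != y :> nat) && (r x y || r y x).
Proof. by rewrite rel_graphE // => u v; rewrite orbC. Qed.

(** Every edge joins some vertex of [D] to its parent under [p], so the edges lie in an image of
    [D]. *)
Lemma card_edges_parent G (p : 'I_n -> 'I_n) (D : {set 'I_n}) :
    (forall x y : 'I_n, x < y -> [set x; y] \in edges G ->
       y \in D /\ x = p y \/ x \in D /\ y = p x) ->
  #|edges G| <= #|D|.
Proof.
move=> Gp; apply: leq_trans (leq_imset_card (fun y => [set y; p y]) D).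
apply: subset_leq_card; apply/subsetP => e eG.
have [x [y [xy def_e]]] := edgeP _ _ eG.
wlog ltxy : x y xy def_e / x < y.
  move=> IH; case: (ltngtP x y) => [||/val_inj/eqP]; last by rewrite (negPf xy).
    exact: IH.
  by apply: (IH y x); rewrite 1?eq_sym // setUC.
have [|[yD def_x]|[xD def_y]] := Gp x y ltxy; first by rewrite -def_e.
  by apply/imsetP; exists y; rewrite // def_e setUC -def_x.
by apply/imsetP; exists x; rewrite // def_e -def_y.
Qed.

(** A star with centre 0 and leaves [1, ..., l], prolonged at the leaf [l] by the path
    [l, l+1, ..., n-1]. For [l = n - 1] it is the star itself. *)
Definition broom (l : nat) : rel nat :=
  fun x y => (x < y) && ((x == 0) && (y <= l) || (l < y) && (y == x.+1)).

(** The edge from 0 to [n-1] closes the path of the broom to the cycle [0, l-1, l, ..., n-1]. It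
    also raises the degree of 0 to [l], whence the broom parameter [l.-1]. *)
Definition lollipop (l : nat) : rel nat :=
  fun x y => broom l.-1 x y || ((x == 0) && (y == n.-1)).

(* The cycle is 0, ..., m-1 and the hub is m. The chords match {0, ..., t-1}
   with {t+1, ..., 2t}; if b holds, 0 is joined to the hub as well. *)
Definition spoke (m t : nat) (b : bool) (x : nat) : bool :=
  (x < m) && [|| x == t, 2 * t < x | b && (x == 0)].

Definition chorded_wheel (m t : nat) (b : bool) : rel nat :=
  fun x y => [|| (y == x.+1) && (y < m), (x == 0) && (y == m.-1),
                 (x < t) && (y == x + t.+1) | (y == m) && spoke m t b x].

Lemma broom_card_edges l : 0 < n -> #|edges (nat_graph (broom l))| <= n.-1.
Proof.
move=> n_gt0; pose o : 'I_n := Ordinal n_gt0.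
have <- : #|[set~ o]| = n.-1 by rewrite cardsC1 card_ord.
apply: (@card_edges_parent _ (fun y => insubd y (if y <= l then 0 else y.-1))).
move=> x y ltxy; rewrite nat_graphE /broom => xyE; left; split.
  by rewrite !inE -val_eqE /=; lia.
by apply: val_inj; rewrite /= val_insubd; have := ltn_ord y;
  case: (leqP y l) xyE; case: ifP; lia.
Qed.

Lemma broom_max_degree l : 1 < l < n -> max_degree (nat_graph (broom l)) = l.
Proof.
move=> /andP[l_gt1 ltln]; have n_gt0 : 0 < n by lia.
apply: (@max_degreeP _ _ (Ordinal n_gt0)) => [x|].
  have [x0|x0] := posnP x.
    rewrite -[leqRHS](size_iota 1 l); apply: degree_le_size => y; rewrite nat_graphE.
    by rewrite mem_iota /broom x0; lia.
  apply: (@leq_trans (size [:: if x <= l then 0 else x.-1; x.+1])) => //.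
  apply: degree_le_size => y; rewrite nat_graphE !inE /broom.
  by case: ifP; lia.
rewrite -[leqLHS](size_iota 1 l); apply: degree_ge_size (iota_uniq _ _) _.
move=> k; rewrite mem_iota => kl; have ltkn : k < n by lia.
by exists (Ordinal ltkn); rewrite // nat_graphE /broom /=; lia.
Qed.

(** Vertices up to [l] are adjacent to 0; a later one follows the path down to [l], provided that
    this segment survives in [W]. Any graph containing the broom is allowed, so that lollipops are
    covered too. *)
Lemma broom_connect_root G l W (x o : 'I_n) :
    (forall u v : 'I_n, broom l u v -> [set u; v] \in edges G) ->
    0 < l < n -> o = 0 :> nat -> x \in W -> o \in W ->
    (l < x -> forall z : 'I_n, l <= z <= x -> z \in W) ->
  connect (fun u v => [&& u \in W, v \in W & [set u; v] \in edges G]) x o.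
Proof.
set e := (fun u v => _) => sub /andP[l_gt0 ltln] o0 xW oW walkW.
have e_sym : connect_sym e.
  by apply: sym_connect_sym => u v; rewrite /e setUC andbCA.
have spoke (z : 'I_n) : z \in W -> z <= l -> connect e z o.
  move=> zW zl; have [z0|z0] := posnP z.
    by rewrite (_ : z = o) //; apply: val_inj; rewrite /= z0 o0.
  by rewrite e_sym connect1 // /e zW oW sub // /broom o0; lia.
case: (leqP x l) => [|ltlx]; first exact: spoke.
have lW := walkW ltlx (Ordinal ltln); rewrite e_sym.
apply: (@connect_trans _ _ (Ordinal ltln)).
  by rewrite e_sym spoke //= lW //= leqnn ltnW.
apply: connect_walk => [|u v /= lu vx def_v]; first exact: ltnW.
rewrite /e !walkW ?sub // /broom; lia.
Qed.

Lemma sub_broom l (u v : 'I_n) :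
  broom l u v -> [set u; v] \in edges (nat_graph (broom l)).
Proof. by rewrite nat_graphE /broom; lia. Qed.

Lemma sub_lollipop l (u v : 'I_n) :
  broom l.-1 u v -> [set u; v] \in edges (nat_graph (lollipop l)).
Proof. by rewrite nat_graphE /lollipop /broom; lia. Qed.

Lemma sdiam_broom l k :
  0 < l < n -> (sdiam k (nat_graph (broom l)) <= ((n - 1)%N%:R)%:E)%E.
Proof.
move=> l_n; have n_gt0 : 0 < n by lia.
apply: sdiam_le_connected => S _; exists [set: 'I_n].
rewrite subsetT cardsT card_ord; split=> //; first by lia.
apply: (@connected_induced_root _ _ (Ordinal n_gt0)) => // x _.
by apply: (@broom_connect_root _ l _ _ _ (sub_broom l)) => [||||_ z _]; rewrite ?inE.
Qed.

Lemma sdiam_star :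
  2 < n -> (sdiam (n - 2) (nat_graph (broom (n - 1))) <= ((n - 2)%N%:R)%:E)%E.
Proof.
move=> n_gt2; have n_gt0 : 0 < n by lia.
(* Adding the centre gives at most [n - 1] vertices, one more than the allowed number of edges. *)
pose o := Ordinal n_gt0; apply: sdiam_le_connected => S cardS; exists (o |: S).
rewrite subsetUr cardsU1 cardS; split=> //; first by case: (o \notin S); lia.
apply: (@connected_induced_root _ _ o) => [|x xW]; first exact: setU11.
apply: (@broom_connect_root _ (n - 1) _ _ _ (sub_broom _)) => //.
- by lia.
- exact: setU11.
- by have := ltn_ord x; lia.
Qed.

Lemma card_order_sub2 S :
  1 < n -> #|S| = n - 2 -> exists a b, a != b /\ S = ~: [set a; b].
Proof.
move=> n_gt1 cardS; have /cards2P[a [b [ab def_S]]] : #|~: S| == 2.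
  by have := cardsC S; rewrite card_ord cardS => /eqP; lia.
by exists a, b; rewrite -def_S setCK.
Qed.

Lemma lollipop_card_edges l : 0 < n -> #|edges (nat_graph (lollipop l))| <= n.
Proof.
move=> n_gt0; rewrite -[leqRHS]card_ord -cardsT.
(* Here 0 gets the parent [n-1], so that the closing edge is counted and all [n] vertices are
   used. *)
apply: (@card_edges_parent _ (fun y => insubd y
  (if y == 0 :> nat then n.-1 else if y <= l.-1 then 0 else y.-1))).
move=> x y ltxy; rewrite nat_graphE /lollipop /broom => xyE.
have [|y_last] := boolP ((x == 0 :> nat) && (y == n.-1 :> nat)).
  case/andP=> /eqP x0 /eqP y_last; right; split=> //; apply: val_inj.
  by rewrite /= val_insubd x0 /=; case: ifP; lia.
left; split=> //; apply: val_inj; rewrite /= val_insubd; have := ltn_ord y.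
by case: (posnP y) => y0; [|case: (leqP y l.-1) xyE]; case: ifP; lia.
Qed.

Lemma lollipop_max_degree l :
  1 < l < n - 1 -> max_degree (nat_graph (lollipop l)) = l.
Proof.
move=> /andP[l_gt1 ltln]; have n_gt0 : 0 < n by lia.
have l_size : size (n.-1 :: iota 1 l.-1) = l by rewrite /= size_iota; lia.
apply: (@max_degreeP _ _ (Ordinal n_gt0)) => [x|].
  have [x0|x0] := posnP x.
    rewrite -[leqRHS]l_size; apply: degree_le_size => y; rewrite nat_graphE.
    by rewrite inE mem_iota /lollipop /broom x0; lia.
  apply: (@leq_trans (size [:: if x <= l.-1 then 0 else x.-1;
                               if x == n.-1 :> nat then 0 else x.+1])) => //.
  apply: degree_le_size => y; rewrite nat_graphE !inE /lollipop /broom.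
  by have := ltn_ord y; do 2!case: ifP; lia.
rewrite -[leqLHS]l_size; apply: degree_ge_size => [|k].
  by rewrite cons_uniq iota_uniq mem_iota andbT; lia.
rewrite inE mem_iota => kl; have ltkn : k < n by lia.
by exists (Ordinal ltkn); rewrite // nat_graphE /lollipop /broom /=; lia.
Qed.

(** The bound [n - 2] leaves room for [n - 1] vertices, so only one of the two vertices outside [S]
    is deleted, chosen as some [b] other than 0. If [b] blocks the way from [x] down the path, [x]
    goes up to [n-1] and from there to 0 by the closing edge. *)
Lemma sdiam_lollipop l :
    1 < l < n - 1 ->
  (sdiam (n - 2) (nat_graph (lollipop l)) <= ((n - 2)%N%:R)%:E)%E.
Proof.
move=> l_n; have n_gt0 : 0 < n by lia.
pose o := Ordinal n_gt0; apply: sdiam_le_connected => S.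
case/card_order_sub2=> [|a [b [ab ->]]]; first by lia.
wlog b0 : a b ab / 0 < b.
  move=> IH; have [b0|] := posnP b; last exact: IH.
  rewrite setUC; apply: IH; first by rewrite eq_sym.
  by rewrite lt0n; apply: contra ab => /eqP a0; apply/eqP/val_inj; rewrite /= a0.
exists (~: [set b]); have bW (z : 'I_n) : (z \in ~: [set b]) = (z != b :> nat).
  by rewrite !inE.
rewrite setCS sub1set !inE eqxx orbT; split=> //.
  by rewrite cardsC1 card_ord; lia.
apply: (@connected_induced_root _ _ o) => [|x xW]; first by rewrite bW /=; lia.
have [/andP[leb ltbx]|far] := boolP (l.-1 <= b < x); last first.
  apply: (@broom_connect_root _ l.-1 _ _ _ (sub_lollipop l)) => //.
  - by lia.
  - by rewrite bW /=; lia.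
  - by move=> _ z; rewrite bW; rewrite bW in xW; lia.
have lt_last : n.-1 < n by lia.
apply: (@connect_trans _ _ (Ordinal lt_last)).
  apply: connect_walk => [|u v /= xu _ def_v]; first by have := ltn_ord x; rewrite /=; lia.
  by rewrite !bW sub_lollipop ?andbT // /broom; lia.
by apply: connect1; rewrite !bW nat_graphE /lollipop /=; have := ltn_ord x; lia.
Qed.

(** * Chorded wheels: degrees, edges and 3-connectedness *)

Lemma chorded_wheel_degree_rim m t (b : bool) (x : 'I_n) :
    n = m.+1 -> 2 * t + 3 <= m -> (b -> 0 < t) -> x < m ->
  degree (nat_graph (chorded_wheel m t b)) x <= 3 + (b && (x == 0 :> nat)).
Proof.
move=> def_n le_m b_t ltxm.
(* Two rim neighbours, then the chord end or else the hub; the extra spoke of 0 is appended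
   below. *)
pose s := [:: if x == 0 :> nat then m.-1 else x.-1; if x == m.-1 :> nat then 0 else x.+1;
  if x < t then x + t.+1 else if t < x <= 2 * t then x - t.+1 else m].
apply: (@leq_trans (size (s ++ nseq (b && (x == 0 :> nat)) m))); last first.
  by rewrite size_cat size_nseq.
apply: degree_le_size => y; rewrite nat_graphE /s /chorded_wheel /spoke mem_cat !inE.
have := ltn_ord y; rewrite mem_nseq.
case: (posnP x) => x0; case: (eqVneq (x : nat) m.-1) => xm; case: (ltnP x t) => xt;
  rewrite ?x0 /=; try case: ifP; case: b b_t => b_t /=; lia.
Qed.

Lemma chorded_wheel_degree_hub m t (b : bool) (h : 'I_n) :
    n = m.+1 -> 2 * t + 3 <= m -> (b -> 0 < t) -> h = m :> nat ->
  degree (nat_graph (chorded_wheel m t b)) h = m - 2 * t + b.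
Proof.
move=> def_n le_m b_t def_h.
(* The spoke ends. When [b] holds, [0 < t] keeps 0 from coinciding with [t]. *)
pose s := [:: t] ++ iota (2 * t).+1 (m - (2 * t).+1) ++ nseq b 0.
have s_size : size s = m - 2 * t + b by rewrite !size_cat size_iota size_nseq /=; lia.
have s_spoke k : (k \in s) = spoke m t b k.
  rewrite /s !mem_cat mem_iota mem_nseq inE /spoke.
  by case: b b_t {s s_size} => /=; lia.
apply/eqP; rewrite eqn_leq -s_size; apply/andP; split.
  apply: degree_le_size => y; rewrite nat_graphE /chorded_wheel s_spoke /spoke.
  by have := ltn_ord y; rewrite def_h; case: b b_t {s s_size s_spoke} => /=; lia.
apply: degree_ge_size => [|k].
  rewrite /s /= cat_uniq iota_uniq mem_cat mem_iota mem_nseq.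
  by case: b b_t {s s_size s_spoke} => b_t; rewrite /= ?mem_iota; lia.
rewrite s_spoke => sp_k; have ltkn : k < n by case/andP: sp_k; lia.
exists (Ordinal ltkn) => //; rewrite nat_graphE /chorded_wheel /= sp_k def_h.
by case/andP: sp_k => ltkm _; rewrite eqxx !orbT andbT; lia.
Qed.

(** A rim vertex has degree at most 4, and more than 3 only if it is 0 and [b] holds, so a hub of
    degree at least 4 attains the maximum. *)
Lemma chorded_wheel_max_degree m t (b : bool) :
    n = m.+1 -> 2 * t + 3 <= m -> (b -> 0 < t) -> 3 < m - 2 * t + b ->
  max_degree (nat_graph (chorded_wheel m t b)) = m - 2 * t + b.
Proof.
move=> def_n le_m b_t l_gt3; have ltmn : m < n by rewrite def_n.
apply: (@max_degreeP _ _ (Ordinal ltmn)) => [x|]; last first.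
  by rewrite chorded_wheel_degree_hub.
have [ltxm|lemx] := ltnP x m.
  apply: leq_trans (chorded_wheel_degree_rim _ _ _ _ def_n le_m b_t ltxm) _.
  by case: (b && _); lia.
by rewrite chorded_wheel_degree_hub //; have := ltn_ord x; lia.
Qed.

(** Degree sum: the hub gives [m - 2 * t + b] and the [m] rim vertices at most 3 each. The last [b]
    is the extra spoke seen from 0. *)
Lemma chorded_wheel_card_edges m t (b : bool) :
    n = m.+1 -> 2 * t + 3 <= m -> (b -> 0 < t) ->
  2 * #|edges (nat_graph (chorded_wheel m t b))| <= m - 2 * t + b + 3 * m + b.
Proof.
move=> def_n le_m b_t; rewrite -sum_degree; have ltmn : m < n by rewrite def_n.
have lt0n : 0 < n by rewrite def_n.
pose h := Ordinal ltmn; pose o := Ordinal lt0n.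
have oh : o != h by rewrite -val_eqE /=; lia.
rewrite (bigD1 h) //= chorded_wheel_degree_hub // -[leqRHS]addnA leq_add2l.
rewrite (bigD1 o) //=.
have := chorded_wheel_degree_rim _ _ _ o def_n le_m b_t _; rewrite /= andbT => dego.
apply: (@leq_trans (3 + b + \sum_(i | (i != h) && (i != o)) 3)).
  apply: leq_add; first by apply: dego; lia.
  apply: leq_sum => x /andP[xh xo].
  have ltxm : x < m by move: xh; rewrite -val_eqE /=; have := ltn_ord x; lia.
  have := chorded_wheel_degree_rim _ _ _ _ def_n le_m b_t ltxm.
  by move: xo; rewrite -val_eqE /= => /negPf->; rewrite andbF addn0.
rewrite sum_nat_const (eq_card (B := ~: [set h; o])) => [|x]; last first.
  by rewrite !inE negb_or.
have := cardsC [set h; o]; rewrite cards2 eq_sym oh card_ord; lia.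
Qed.

(* A rim vertex without a spoke that is cut off from the spokes in both
   directions along the rim has both deleted vertices next to its own chord
   class, so the other chord class and its spokes survive. *)
Lemma sdiam_chorded_wheel m t (b : bool) :
    n = m.+1 -> 2 * t + 3 <= m ->
  (sdiam (n - 2) (nat_graph (chorded_wheel m t b)) <= ((n - 3)%N%:R)%:E)%E.
Proof.
move=> def_n le_m; have ltmn : m < n by rewrite def_n.
pose h := Ordinal ltmn; apply: sdiam_le_connected => S.
case/card_order_sub2=> [|c [d [cd def_S]]]; first by lia.
(* With [n - 3] edges there is no room for a further vertex, so [S] itself must induce a connected
   graph. *)
exists S; rewrite subxx; split=> //.
  by have := cardsC [set c; d]; rewrite cards2 cd card_ord -def_S; lia.
have SE (z : 'I_n) : (z \in S) = (z != c :> nat) && (z != d :> nat).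
  by rewrite def_S !inE negb_or.
(* At most one of the two deleted vertices is the hub. *)
clear def_S; wlog dh : c d cd SE / c < m.
  move=> IH; have [|lemc] := ltnP c m; first exact: (IH c d cd SE).
  apply: (IH d c) => [|z|]; first by rewrite eq_sym.
    by rewrite SE andbC.
  by move: cd; rewrite -val_eqE /=; have := ltn_ord c; have := ltn_ord d; lia.
pose e u v := [&& u \in S, v \in S &
  [set u; v] \in edges (nat_graph (chorded_wheel m t b))].
have e_sym : connect_sym e.
  by apply: sym_connect_sym => u v; rewrite /e setUC andbCA.
have ord k : k < n -> exists z : 'I_n, z = k :> nat.
  by move=> ltkn; exists (Ordinal ltkn).
have step (u v : 'I_n) : u \in S -> v \in S -> u != v :> nat ->
    chorded_wheel m t b u v -> connect e u v.
  by move=> uS vS uv ruv; apply: connect1; rewrite /e uS vS nat_graphE uv ruv.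
have walk (x y : 'I_n) : x <= y < m ->
    (forall z : 'I_n, x <= z <= y -> z \in S) -> connect e x y.
  move=> /andP[lexy ltym] xyS; apply: connect_walk => // u v xu vy def_v.
  rewrite /e !xyS ?nat_graphE /chorded_wheel; lia.
have [o o0] : exists z : 'I_n, z = 0 :> nat by apply: ord; lia.
have [p pm] : exists z : 'I_n, z = m.-1 :> nat by apply: ord; lia.
(* If the hub is deleted, the rim without [c] is a path, crossing from [m-1] to 0 unless [c] is one
   of these. *)
have [hS|hS] := boolP (h \in S); last first.
  have {hS} dm : d = m :> nat by move: hS; rewrite SE /=; lia.
  have ltS (z : 'I_n) : z \in S -> z < m by rewrite SE; have := ltn_ord z; lia.
  have [c0|c0] := posnP c.
    apply: (@connected_induced_root _ _ p) => [|x xS]; first by rewrite SE; lia.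
    apply: walk => [|z]; first by have := ltS x xS; lia.
    by move: xS; rewrite !SE; lia.
  have oS : o \in S by rewrite SE; lia.
  apply: (@connected_induced_root _ _ o) => // x xS; have ltxm := ltS x xS.
  have [ltxc|ltcx] := ltnP x c.
    by rewrite e_sym; apply: walk => [|z]; rewrite ?SE; lia.
  rewrite SE in xS; apply: (@connect_trans _ _ p).
    by apply: walk => [|z]; rewrite ?SE; lia.
  by rewrite e_sym; apply: step => //; rewrite ?SE /chorded_wheel; lia.
apply: (@connected_induced_root _ _ h) => // x xS.
have hub (z : 'I_n) : z \in S -> spoke m t b z -> connect e z h.
  move=> zS sp_z; apply: step => //; last by rewrite /chorded_wheel sp_z eqxx !orbT.
  by case/andP: sp_z => /=; lia.
have [xm|xm] := eqVneq (x : nat) m.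
  by rewrite (_ : x = h) //; apply: val_inj.
have ltxm : x < m by have := ltn_ord x; lia.
have [sp_x|nsp_x] := boolP (spoke m t b x); first exact: hub.
have xt : x < t \/ t < x <= 2 * t by move: nsp_x; rewrite /spoke; lia.
(* The exits to the hub are [t], [2t+1] and [m-1]; the last two differ because [2 * t + 3 <= m]. *)
have [k kt] : exists z : 'I_n, z = t :> nat by apply: ord; lia.
have [q qt] : exists z : 'I_n, z = (2 * t).+1 :> nat by apply: ord; lia.
have sp_k : spoke m t b k by rewrite /spoke; lia.
have sp_q : spoke m t b q by rewrite /spoke; lia.
have sp_p : spoke m t b p by rewrite /spoke; lia.
have around (z : 'I_n) : z < m -> (forall u : 'I_n, u <= z -> u \in S) -> p \in S ->
    connect e z h.
  move=> ltzm zS pS; apply: (@connect_trans _ _ o).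
    by rewrite e_sym; apply: walk => [|u]; [lia | move=> /andP[_ /zS]].
  apply: connect_trans (hub p pS sp_p); apply: step => //; first by apply: zS; lia.
    by lia.
  by rewrite /chorded_wheel; lia.
have up (z y : 'I_n) : z <= y < m -> spoke m t b y ->
    (forall u : 'I_n, z <= u <= y -> u \in S) -> connect e z h.
  move=> zy sp_y zyS; apply: connect_trans (walk _ _ zy zyS) (hub y _ sp_y).
  by apply: zyS; lia.
rewrite SE in xS; case: xt => xt.
  (* First class: try the exit [t], then the way through 0 to [m-1]. If both are blocked, no vertex
     from [t+1] to [2t+1] is deleted, and the chord leads to the exit [2t+1]. *)
  have [fwd|fwd] := boolP (((c < x) || (t < c)) && ((d < x) || (t < d))).
    by apply: (up x k) => // [|u]; rewrite ?SE; lia.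
  have [bwd|bwd] := boolP [&& x < c, x < d, c != m.-1 :> nat & d != m.-1 :> nat].
    by apply: around => // [u|]; rewrite SE; lia.
  have [y yx] : exists z : 'I_n, z = x + t.+1 :> nat by apply: ord; lia.
  apply: (@connect_trans _ _ y).
    by apply: step; rewrite ?SE /chorded_wheel; lia.
  by apply: (up y q) => // [|u]; rewrite ?SE; lia.
(* Second class: try the exits [2t+1] and [t]. If both are blocked, the deleted vertices lie between
   [t] and [2t+1], so the chord end can go through 0 to [m-1]. *)
have [fwd|fwd] := boolP (((c < x) || ((2 * t).+1 < c)) && ((d < x) || ((2 * t).+1 < d))).
  by apply: (up x q) => // [|u]; rewrite ?SE; lia.
have [bwd|bwd] := boolP (((c < t) || (x < c)) && ((d < t) || (x < d))).
  apply: (@connect_trans _ _ k); last by apply: hub; rewrite ?SE; lia.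
  by rewrite e_sym; apply: walk => [|u]; rewrite ?SE; lia.
have [y yx] : exists z : 'I_n, z = x - t.+1 :> nat by apply: ord; lia.
apply: (@connect_trans _ _ y).
  by rewrite e_sym; apply: step; rewrite ?SE /chorded_wheel; lia.
by apply: around => // [|u|]; rewrite ?SE; lia.
Qed.

End Constructions.

(** * Values of the minimum *)

Lemma emin_eq k n l d v :
    (forall G : sgraph 'I_n, max_degree G = l -> (sdiam k G <= (d%:R)%:E)%E ->
       v <= #|edges G|) ->
    (exists G : sgraph 'I_n,
       [/\ max_degree G = l, (sdiam k G <= (d%:R)%:E)%E & #|edges G| <= v]) ->
  emin k n l d = (v%:R)%:E.
Proof.
move=> lower [G [degG diamG leG]]; apply/eqP; rewrite eq_le; apply/andP; split.
  apply: (bigmin_inf G); first by rewrite inE degG eqxx.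
  by rewrite lee_fin ler_nat.
apply/bigmin_geP; split=> [|H]; first exact: leey.
by rewrite inE => /andP[/eqP degH diamH]; rewrite lee_fin ler_nat lower.
Qed.

Lemma emin_order_minus1 n l :
  4 < n -> 2 <= l <= n - 1 -> emin (n - 2) n l (n - 1) = ((n - 1)%N%:R)%:E.
Proof.
move=> n_gt4 l_n; apply: emin_eq => [G _ diam|].
  have := sdiam_card_edges _ _ G _ diam; rewrite card_ord.
  by move/(_ ltac:(lia)); lia.
exists (nat_graph (broom l)); split.
- by apply: broom_max_degree; lia.
- by apply: sdiam_broom; lia.
- by have := @broom_card_edges n l; lia.
Qed.

Lemma emin_order_minus2_star n :
  4 < n -> emin (n - 2) n (n - 1) (n - 2) = ((n - 1)%N%:R)%:E.
Proof.
move=> n_gt4; apply: emin_eq => [G _ diam|].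
  have := sdiam_card_edges _ _ G _ diam; rewrite card_ord.
  by move/(_ ltac:(lia)); lia.
exists (nat_graph (broom (n - 1))); split.
- by apply: broom_max_degree; lia.
- by apply: sdiam_star; lia.
- by have := @broom_card_edges n (n - 1); lia.
Qed.

Lemma emin_order_minus2 n l :
  4 < n -> 2 <= l <= n - 2 -> emin (n - 2) n l (n - 2) = (n%:R)%:E.
Proof.
move=> n_gt4 l_n; apply: emin_eq => [G degG diam|].
  have := sdiam_edges_ge_order G; rewrite card_ord degG; apply=> //; lia.
exists (nat_graph (@lollipop n l)); split.
- by apply: lollipop_max_degree; lia.
- by apply: sdiam_lollipop; lia.
- by apply: lollipop_card_edges; lia.
Qed.

(** The value is half of [3 * (n - 1) + l], rounded up; all of part (3) follows from this
    formula. *)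
Lemma emin_order_minus3 n l :
    4 <= l <= n - 1 ->
  emin (n - 2) n l (n - 3) = (((3 * n + l - 2)./2)%N%:R)%:E.
Proof.
move=> l_n; apply: emin_eq => [G degG diam|].
  have := sdiam_double_edges G; rewrite card_ord degG => /(_ _ diam); lia.
(* Chosen so that the hub has degree [l], with [b] the parity that the rounding absorbs. The room
   [2 * t + 3 <= n.-1] comes from [4 <= l]. *)
pose t := uphalf (n - 1 - l); pose b := odd (n - 1 - l).
have def_l : l = n.-1 - 2 * t + b by rewrite /t /b; lia.
have def_n : n = n.-1.+1 by lia.
have le_m : 2 * t + 3 <= n.-1 by rewrite /t; lia.
have b_t : b -> 0 < t by rewrite /t /b; lia.
exists (nat_graph (chorded_wheel n.-1 t b)); split.
- by rewrite [RHS]def_l; apply: chorded_wheel_max_degree => //; rewrite -def_l; lia.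
- exact: sdiam_chorded_wheel.
- have := chorded_wheel_card_edges _ _ _ def_n le_m b_t; rewrite -def_l /b; lia.
Qed.

Theorem theorem3p1 (n : nat) (hn : (5 <= n)%N) :
  [/\ (* (1) *)
      forall l : nat, (2 <= l <= n - 1)%N ->
        emin (n - 2) n l (n - 1) = ((n - 1)%N%:R)%:E,
      (* (2) *)
      forall l : nat, (2 <= l <= n - 1)%N ->
        ((2 <= l <= n - 2)%N -> emin (n - 2) n l (n - 2) = (n%:R)%:E) /\
        (l = (n - 1)%N -> emin (n - 2) n l (n - 2) = ((n - 1)%N%:R)%:E),
      (* (3), first part *)
      forall i : nat, (i = 0%N \/ i = 1%N) ->
        [/\ (5 + i <= n)%N ->
              emin (n - 2) n (n - 1 - i) (n - 3) = ((2 * n - 2)%N%:R)%:E,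
            (7 + 2 * i <= n)%N ->
              emin (n - 2) n (n - 3 - i) (n - 3) = ((2 * n - 3)%N%:R)%:E,
            (11 + 2 * i <= n)%N ->
              emin (n - 2) n (n - 5 - i) (n - 3) = ((2 * n - 4)%N%:R)%:E &
            (15 + 2 * i <= n)%N ->
              emin (n - 2) n (n - 7 - i) (n - 3) = ((2 * n - 5)%N%:R)%:E]
    & (* (3), second part *)
      forall l : nat, (6 <= l <= n - 9)%N ->
        exists s : nat,
          [/\ unique (fun s' : nat => (2 <= s' <= 5)%N /\
                exists2 r : nat, (1 <= r)%N & n = (4 * r + l + s' + 3)%N) s,
              ((((3 * n%:R + l%:R - 3) / 2)%R : rat)%:E
                 <= emin (n - 2) n l (n - 3))%E,
              (emin (n - 2) n l (n - 3)
                 <= (((3 * n%:R + l%:R + s%:R - 5) / 2)%R : rat)%:E)%E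
            & s = 2%N ->
              emin (n - 2) n l (n - 3) =
                (((3 * n%:R + l%:R - 3) / 2)%R : rat)%:E]].
Proof.
split=> [l|l l_n|i i01|l l_n]; first exact: emin_order_minus1.
- by split=> [|->]; [exact: emin_order_minus2 | exact: emin_order_minus2_star].
(* In each case the rounding gives the same value for [i = 0] and [i = 1]. *)
- by split=> n_i; rewrite emin_order_minus3; try lia; congr (_%:R%:E)%R; lia.
(* The relation reads [n - l - 5 = 4r + (s - 2)] with remainder [s - 2 < 4], and [l <= n - 9] gives
   [r >= 1]. Below, the local [s] is this remainder, two less than the [s] of the statement. *)
have eq_n := divn_eq (n - l - 5) 4; have lt4 := ltn_pmod (n - l - 5) (isT : 0 < 4).
exists (2 + (n - l - 5) %% 4).
set r := (n - l - 5) %/ 4 in eq_n; set s := (n - l - 5) %% 4 in eq_n lt4 *.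
rewrite emin_order_minus3; last by lia.
set v := (_./2).
have lower : ((3 * n + l)%N%:R <= (2 * v + 3)%N%:R :> rat)%R.
  by rewrite ler_nat /v; lia.
(* For remainder 0, [3 * n + l] is odd, so the halving in [v] loses 1/2 and the upper bound meets
   the lower one. *)
have upper : ((2 * v + 5)%N%:R <= (3 * n + l + (2 + s))%N%:R :> rat)%R.
  by rewrite ler_nat /v; lia.
rewrite natrD; rewrite !natrD in lower upper.
split.
- split=> [|s' [s'_le [r' r'_gt0 def_n]]]; last by lia.
  by split; [lia | exists r; lia].
- by rewrite lee_fin; lra.
- by rewrite lee_fin; lra.
- by move=> s0; congr (_%:E); have {}s0 : s = 0 by [lia]; move: upper; rewrite s0; lra.
Qed.
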